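(* Let $A_n$ be the connected anti-regular graph with $n=2k$ vertices. Let its positive eigenvalues be $\lambda^+_1<\dots<\lambda^+_k$ and its negative eigenvalues other than $-1$ be $\lambda^-_{k-1}<\dots<\lambda^-_1$. For $\theta\in[0,\pi)$ let \[f_1(\theta)=\frac{-(\cos\theta+1)+\sqrt{(\cos\theta+1)(\cos\theta+3)}}{2(\cos\theta+1)},\qquad f_2(\theta)=\frac{-(\cos\theta+1)-\sqrt{(\cos\theta+1)(\cos\theta+3)}}{2(\cos\theta+1)},\] let $f_1'$ be the derivative of $f_1$, and let $\gamma_j=\frac{2\pi j}{2k-1}$. Then for $1\le j\le k-1$, \[|\lambda^+_j-f_1(\gamma_j)|\le\frac{2\pi f_1'(\gamma_j)}{2k-1}\quad\text{and}\quad|\lambda^-_j-f_2(\gamma_j)|\le\frac{2\pi f_1'(\gamma_j)}{2k-1}.\]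
   Context: A simple graph is anti-regular if exactly two of its vertices have the same degree. For each $n\ge2$, $A_n$ denotes the unique (up to isomorphism) connected anti-regular graph on $n$ vertices; for $n$ even it is the threshold graph with creation sequence $(0,1,0,1,\dots,0,1)$, where a $1$ means the new vertex is joined to all previous vertices and a $0$ means it is added isolated. Eigenvalues are those of the adjacency matrix; for $n=2k$ they are simple and consist of $-1$, $k$ positive and $k-1$ other negative eigenvalues. *)

(* Defs.v *)
From HB Require Import structures.
From mathcomp Require Import all_boot all_order all_algebra.
From mathcomp Require Import all_classical all_reals all_analysis.

Set Implicit Arguments.
Unset Strict Implicit.
Unset Printing Implicit Defensive.

Import Order.TTheory GRing.Theory Num.Theory.
Import numFieldNormedType.Exports.

Local Open Scope ring_scope.

(* A graph on n labelled vertices is given by its adjacency relation. *)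
Definition simple_graph (n : nat) (e : rel 'I_n) : Prop :=
  symmetric e /\ irreflexive e.

Definition connected_graph (n : nat) (e : rel 'I_n) : Prop :=
  forall x y, connect e x y.

Definition degree (n : nat) (e : rel 'I_n) (x : 'I_n) : nat :=
  #|[set y | e x y]|.

(* Exactly one unordered pair of distinct vertices has equal degrees. *)
Definition antiregular (n : nat) (e : rel 'I_n) : Prop :=
  exists u v, [/\ u != v, degree e u = degree e v &
    forall x y, x != y -> degree e x = degree e y ->
      [set x; y]%SET = [set u; v]%SET].

Definition adjacency (R : realType) (n : nat) (e : rel 'I_n) : 'M[R]_n :=
  \matrix_(i, j) (e i j)%:R.

(* Only meaningful for t in [0, pi[; at pi the denominator vanishes. *)
Definition f1 (R : realType) (t : R) : R :=
  (- (cos t + 1) + Num.sqrt ((cos t + 1) * (cos t + 3))) / (2 * (cos t + 1)).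

Definition f2 (R : realType) (t : R) : R :=
  (- (cos t + 1) - Num.sqrt ((cos t + 1) * (cos t + 3))) / (2 * (cos t + 1)).

Definition gamma (R : realType) (k j : nat) : R :=
  2 * pi * j%:R / (2 * k%:R - 1).

(* Main.v *)
(* Labelling the vertices by degree makes the graph the threshold graph
   [i ~ j <-> i + j >= n - 1], so the tail sums of an eigenvector for [a] satisfy
   a three-term recurrence solved by [(-1)^m sin (m t)] when
   [a (a + 1) (2 + 2 cos t) = 1], that is [a = f1 t] or [a = f2 t], subject to
   [(a - 1) sin (k t) + a sin ((k - 1) t) = 0].  At [t = gamma_j] the left-hand
   side is [(-1)^(j+1) sin (t / 2)] whatever [a] is, so the intermediate value
   theorem gives a root between consecutive [gamma]'s on each branch; together
   with [-1] these are [2k] eigenvalues, hence all of them.  The bound is then the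
   mean value theorem, since [f1'] is nondecreasing and [f2 = -1 - f1]. *)
Require Import Defs.
From HB Require Import structures.
From mathcomp Require Import all_boot all_order all_algebra.
From mathcomp Require Import all_classical all_reals all_analysis.
From mathcomp Require Import ring lra zify.

Set Implicit Arguments.
Unset Strict Implicit.
Unset Printing Implicit Defensive.

Import Order.TTheory GRing.Theory Num.Theory.
Import numFieldNormedType.Exports.

Local Open Scope ring_scope.

(** * From anti-regularity to the threshold graph *)

Lemma degree_lt (n : nat) (e : rel 'I_n) (x : 'I_n) :
  irreflexive e -> (degree e x < n)%N.
Proof.
move=> e_irr; rewrite -[X in (_ < X)%N](card_ord n) -cardsT.
apply: proper_card; apply/properP; split; first exact: finset.subsetT.
by exists x; rewrite ?inE // e_irr.
Qed.

Lemma connected_degree_gt0 (n : nat) (e : rel 'I_n) (x : 'I_n) :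
  connected_graph e -> (1 < n)%N -> (0 < degree e x)%N.
Proof.
move=> e_conn n_gt1.
have [y yx] : exists y : 'I_n, y != x.
  apply/existsP; rewrite -negb_forall; apply/forallP => all_x.
  have: (n <= 1)%N.
    rewrite -(card_ord n) -(card1 x); apply: subset_leq_card.
    by apply/fintype.subsetP => y _; rewrite inE; apply: all_x.
  by rewrite leqNgt n_gt1.
have /connectP[[|z p] /= path_p y_last] := e_conn x y.
  by rewrite y_last eqxx in yx.
case/andP: path_p => exz _.
by rewrite /degree card_gt0; apply/set0Pn; exists z; rewrite inE.
Qed.

(** Degrees lie in [1..n-1] and only one value [r] is repeated, so opening a gap at [r] turns them
    into distinct labels in [0..n-1]: degrees up to [r] are lowered by one, larger ones are kept,
    and the second vertex of degree [r] takes the label [r]. *)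
Lemma antiregular_label (n : nat) (e : rel 'I_n) :
    (1 < n)%N -> simple_graph e -> connected_graph e -> antiregular e ->
  exists r : nat, exists2 l : 'I_n -> 'I_n, injective l &
    forall x, (degree e x + (r <= l x) = (l x).+1)%N.
Proof.
move=> n_gt1 [_ e_irr] e_conn [u [v [uv duv anti]]].
pose r := degree e u.
have r_lt : (r < n)%N by exact: degree_lt.
pose m x := if x == v then r
  else if (degree e x <= r)%N then (degree e x).-1 else degree e x.
have d_lt x : (degree e x < n)%N by exact: degree_lt.
have d_gt0 x : (0 < degree e x)%N by exact: connected_degree_gt0.
have m_lt x : (m x < n)%N.
  by rewrite /m; case: ifP => // _; case: ifP => _; have := d_lt x; lia.
exists r; exists (fun x => Ordinal (m_lt x)); last first.
  move=> x; have := d_gt0 x; rewrite /= /m.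
  case: eqP => [->|_]; first by rewrite -duv -/r; lia.
  by case: ifP; lia.
(* A coincidence of degrees can only occur on the pair [u], [v], so deleting [v] leaves distinct
   degrees. *)
have d_inj x y : x != v -> y != v -> degree e x = degree e y -> x = y.
  move=> xv yv dxy; apply/eqP; apply: contraT => xy.
  have := anti x y xy dxy => /setP /(_ v).
  by rewrite !inE eqxx orbT ![v == _]eq_sym (negbTE xv) (negbTE yv).
move=> x y [] /eqP; have := d_gt0 x; have := d_gt0 y; have := d_gt0 u.
rewrite /m -/r; case: (eqVneq x v) => [->|xv]; case: (eqVneq y v) => [->|yv] //.
- by case: ifP; lia.
- by case: ifP; lia.
- by move=> gu gy gx /eqP; case: ifP; case: ifP => *; apply: d_inj => //; lia.
Qed.

Lemma card_tail_label (n m : nat) (l : 'I_n -> 'I_n) :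
  injective l -> (#|[set y | (m <= l y)%N]| = n - m)%N.
Proof.
move=> l_inj.
have -> : [set y | (m <= l y)%N] = l @^-1: [set i : 'I_n | (m <= i)%N].
  by apply/setP => y; rewrite !inE.
rewrite on_card_preimset; last first.
  by apply: onW_bij; apply: injF_bij.
rewrite -sum1dep_card big_mkcond /=.
rewrite -(big_mkord predT (fun i => if (m <= i)%N then 1%N else 0%N)).
case: (leqP m n) => mn; last first.
  rewrite big_nat big1; last by move=> i /andP[_ im]; rewrite leqNgt (ltn_trans im).
  by lia.
rewrite (big_cat_nat (n := m)) //= big_nat big1; last first.
  by move=> i /andP[_ im]; rewrite leqNgt im.
rewrite big_nat (eq_bigr (fun=> 1%N)) => [|i /andP[-> _] //].
by rewrite -big_nat sum_nat_const_nat muln1.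
Qed.

(* The odd weight [W x y = 2 (l x + l y) - (4k - 3)] is positive exactly on the
   pairs in [s], so [\sum (s - e) W >= 0] with equality only if [e = s]; this sum
   depends only on degrees, and computes to a nonpositive number. *)
Lemma antiregular_threshold (k : nat) (e : rel 'I_(2 * k)) (r : nat)
    (l : 'I_(2 * k) -> 'I_(2 * k)) :
    simple_graph e -> injective l ->
    (forall x, (degree e x + (r <= l x) = (l x).+1)%N) ->
  forall x y, e x y = (x != y) && (2 * k - 1 <= l x + l y)%N.
Proof.
move=> [e_sym e_irr] l_inj deg_e.
pose s x y := (x != y) && (2 * k - 1 <= l x + l y)%N.
pose D x y : int := (s x y)%:R - (e x y)%:R.
pose L x : int := (l x)%:Z.
pose W x y : int := 2 * (L x + L y) - (4 * k%:Z - 3).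
have D_sym x y : D x y = D y x by rewrite /D /s e_sym eq_sym addnC.
(* The tail starting at [2k - 1 - l x] holds [l x + 1] labels, and it contains [l x] itself exactly
   when [k <= l x]. *)
have deg_s x : (degree s x + (k <= l x) = (l x).+1)%N.
  have -> : (degree s x = #|[set y | (2 * k - 1 - l x <= l y)%N] :\ x|)%N.
    by rewrite /degree; apply: eq_card => y; rewrite !inE /s eq_sym -(leq_subLR (2 * k - 1)%N (l x)).
  have := cardsD1 x [set y | (2 * k - 1 - l x <= l y)%N].
  rewrite card_tail_label // inE.
  by have := ltn_ord (l x); lia.
have row_D x : \sum_y D x y = (r <= l x)%N%:R - (k <= l x)%N%:R.
  rewrite sumrB -!natr_sum -!big_mkcond /= !sum1dep_card.
  by have := deg_s x; have := deg_e x; rewrite /degree; lia.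
have W_ge0 x y : 0 <= D x y * W x y.
  rewrite /D /s /W /L; case: (eqVneq x y) => [->|xy] /=.
    by rewrite e_irr subrr mul0r.
  by case: (leqP (2 * k - 1) (l x + l y)) => /= H; case: (e x y); lia.
have W_sum : \sum_x \sum_y D x y * W x y =
    \sum_x ((r <= l x)%N%:R - (k <= l x)%N%:R) * (4 * L x - (4 * k%:Z - 3)).
  have -> : \sum_x \sum_y D x y * W x y =
    \sum_x \sum_y D x y * (4 * L x - (4 * k%:Z - 3))
     + 2 * (\sum_x \sum_y D x y * L y - \sum_x \sum_y D x y * L x).
    rewrite -sumrB mulr_sumr -big_split /=; apply: eq_bigr => x _.
    rewrite -sumrB mulr_sumr -big_split /=; apply: eq_bigr => y _.
    by rewrite /W; ring.
  rewrite [X in 2 * (X - _)]exchange_big /=.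
  rewrite (_ : \sum_x \sum_y D y x * L x = \sum_x \sum_y D x y * L x); last first.
    by apply: eq_bigr => x _; apply: eq_bigr => y _; rewrite D_sym.
  rewrite subrr mulr0 addr0; apply: eq_bigr => x _.
  by rewrite -mulr_suml row_D.
have W_sum0 : \sum_x \sum_y D x y * W x y = 0.
  apply/eqP; rewrite eq_le; apply/andP; split; last first.
    by apply: sumr_ge0 => x _; apply: sumr_ge0 => y _.
  (* The first factor is [1] when [r <= l x < k], where the second is at most [-1]; it is [-1] when
     [k <= l x < r], where the second is at least [3]; otherwise it is [0]. *)
  rewrite W_sum; apply: sumr_le0 => x _; rewrite /L.
  by case: (leqP r (l x)); case: (leqP k (l x)) => /=; lia.
move=> x y.
have /eqP := W_sum0; rewrite psumr_eq0; last first.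
  by move=> z _; apply: sumr_ge0 => t _.
move=> /allP /(_ x); rewrite mem_index_enum => /(_ isT) /=.
rewrite psumr_eq0 // => /allP /(_ y); rewrite mem_index_enum => /(_ isT) /=.
rewrite mulf_eq0 => /orP[|].
  by rewrite /D /s subr_eq0; case: (e x y); case: (_ && _).
by rewrite /W /L; lia.
Qed.

Local Ltac split_bools := repeat match goal with
  | |- context [nat_of_bool ?b] =>
      lazymatch b with true => fail | false => fail | _ => case: (boolP b) => ? end
  end; first [exfalso; lia | rewrite /=; ring].

(** * Eigenvectors of the threshold graph *)

(** The neighbours of the vertex labelled [i] form the tail of labels from [2k - 1 - i] on, with [i]
    removed when it belongs to that tail, that is when [k <= i]. Moving the removed term to the
    other side gives the hypothesis on [X]. *)
Lemma eigenvalue_of_tail_sums (R : realType) (k : nat) (e : rel 'I_(2 * k))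
    (l : 'I_(2 * k) -> 'I_(2 * k)) (X : nat -> R) (a : R) (i0 : nat) :
    injective l ->
    (forall x y, e x y = (x != y) && (2 * k - 1 <= l x + l y)%N) ->
    (forall i, (i < 2 * k)%N ->
       \sum_(2 * k - 1 - i <= j < 2 * k) X j = (a + (k <= i)%N%:R) * X i) ->
    (i0 < 2 * k)%N -> X i0 != 0 ->
  eigenvalue (adjacency R e) a.
Proof.
move=> l_inj eE X_tail i0_lt X_i0.
have l_bij : bijective l := injF_bij l_inj.
apply/eigenvalueP; exists (\row_x X (l x)); last first.
  have [l' _ l'K] := l_bij.
  apply: contraNneq X_i0 => /rowP /(_ (l' (Ordinal i0_lt))).
  by rewrite !mxE l'K /= => ->.
apply/rowP => x; rewrite !mxE.
under eq_bigr => y _ do rewrite !mxE eE.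
pose m := (2 * k - 1 - l x)%N.
have tail : \sum_y X (l y) * (m <= l y)%N%:R = (a + (k <= l x)%N%:R) * X (l x).
  rewrite -X_tail // -/m (big_nat_widenl _ 0) //.
  rewrite big_mkcond big_mkord.
  rewrite [RHS](reindex l) /=; last exact: onW_bij.
  by apply: eq_bigr => y _; case: ifP; rewrite ?mulr1 ?mulr0.
transitivity (\sum_y X (l y) * (m <= l y)%N%:R - (k <= l x)%N%:R * X (l x)).
  rewrite [X in _ = X - _](bigD1 x) //= [LHS](bigD1 x) //= eqxx /= mulr0 add0r.
  have -> : (m <= l x)%N = (k <= l x)%N by rewrite /m; lia.
  rewrite [X in X + _ - _]mulrC addrAC subrr add0r; apply: eq_bigr => y yx.
  by rewrite yx /m (leq_subLR (2 * k - 1)%N) addnC.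
by rewrite tail; ring.
Qed.

(** The vertices labelled [k - 1] and [k] are adjacent and have the same other neighbours, so the
    difference of their indicators is an eigenvector. *)
Lemma threshold_eigenvalueN1 (R : realType) (k : nat) (e : rel 'I_(2 * k))
    (l : 'I_(2 * k) -> 'I_(2 * k)) :
    (0 < k)%N -> injective l ->
    (forall x y, e x y = (x != y) && (2 * k - 1 <= l x + l y)%N) ->
  eigenvalue (adjacency R e) (-1).
Proof.
move=> k_gt0 l_inj eE.
pose X i : R := (i == k)%:R - (i.+1 == k)%:R.
apply: (eigenvalue_of_tail_sums (X := X) (i0 := k) l_inj eE); last 2 first.
- by lia.
- by rewrite /X eqxx gtn_eqF // subr0 oner_neq0.
move=> i i_lt.
pose Y i : R := (k < i)%N%:R - (k <= i)%N%:R.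
have XE j : X j = Y j.+1 - Y j by rewrite /X /Y; split_bools.
under eq_bigr do rewrite XE.
rewrite telescope_sumr; last by lia.
by rewrite XE /Y; split_bools.
Qed.

Lemma sin_three_term (R : realType) (t : R) (m : nat) :
  sin (m.+2%:R * t) + sin (m%:R * t) = 2 * cos t * sin (m.+1%:R * t).
Proof.
have -> : m.+2%:R * t = m.+1%:R * t + t by rewrite -natr1; ring.
have -> : m%:R * t = m.+1%:R * t - t by rewrite -[m.+1%:R]natr1; ring.
by rewrite sinD sinB; ring.
Qed.

(** [Z i] is the sum of [X] from [i] on, so the eigenvector equation is read off once
    [X j = Z j - Z j.+1]. Below [k - 1] this is the recurrence of [A], from [k] on it is the
    definition, and at the junction [j = k - 1] it is the last hypothesis. *)
Lemma threshold_eigenvalue_trig (R : realType) (k : nat) (e : rel 'I_(2 * k))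
    (l : 'I_(2 * k) -> 'I_(2 * k)) (t a : R) :
    (0 < k)%N -> injective l ->
    (forall x y, e x y = (x != y) && (2 * k - 1 <= l x + l y)%N) ->
    a != 0 -> sin t != 0 -> a * (a + 1) * (2 + 2 * cos t) = 1 ->
    (a - 1) * sin (k%:R * t) + a * sin ((k - 1)%N%:R * t) = 0 ->
  eigenvalue (adjacency R e) a.
Proof.
move=> k_gt0 l_inj eE a_neq0 sin_neq0 a_cos a_sin.
pose A m : R := (-1) ^+ m * sin (m%:R * t).
pose X i := if (i < k)%N then A i.+1 / a else A (2 * k - i)%N - A (2 * k - 1 - i)%N.
pose Z i := if (i < k)%N then (a + 1) * (A i.+1 - A i) else A (2 * k - i)%N.
have A0 : A 0%N = 0 by rewrite /A mul0r sin0 mulr0.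
have A_rec m : a * (a + 1) * (2 * A m.+1 - A m - A m.+2) = A m.+1.
  transitivity (a * (a + 1) * (2 + 2 * cos t) * A m.+1); last by rewrite a_cos mul1r.
  rewrite /A !exprS.
  have -> : sin (m.+2%:R * t) = 2 * cos t * sin (m.+1%:R * t) - sin (m%:R * t).
    by rewrite -sin_three_term addrK.
  by ring.
have A_end : (a - 1) * A k = a * A (k - 1)%N.
  apply/eqP; rewrite -subr_eq0; apply/eqP.
  transitivity ((-1) ^+ k *
      ((a - 1) * sin (k%:R * t) + a * sin ((k - 1)%N%:R * t))); last first.
    by rewrite a_sin mulr0.
  have E : (-1) ^+ k = - (-1) ^+ (k - 1) :> R.
    by rewrite -[in LHS](subnK k_gt0) addn1 exprS mulN1r.
  by rewrite /A E; ring.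
have XE j : X j = - Z j.+1 - - Z j.
  rewrite /X /Z opprK; case: (ltngtP j.+1 k) => [jk|jk|jk].
  - by rewrite -[X in X / a]A_rec; field.
  - rewrite [RHS]addrC; congr (A _ - A _); lia.
  - rewrite jk (_ : 2 * k - k = k)%N; last lia.
    have -> : j = (k - 1)%N by lia.
    apply: (mulfI a_neq0); rewrite mulrCA mulfV // mulr1.
    transitivity (- (a * A k) + (a + 1) * (a * A k - a * A (k - 1)%N)); last by ring.
    by rewrite -A_end; ring.
apply: (eigenvalue_of_tail_sums (X := X) (i0 := 0) l_inj eE); last 2 first.
- by lia.
- by rewrite /X k_gt0 mulf_neq0 ?invr_eq0 // /A mul1r mulf_neq0 // signr_eq0.
move=> i i_lt.
under eq_bigr do rewrite XE.
rewrite telescope_sumr; last by lia.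
rewrite /Z /X (ltnNge (2 * k)) (_ : (k <= 2 * k)%N) ?subnn ?A0; last lia.
case: (ltnP i k) => ik.
  have -> : (2 * k - 1 - i < k)%N = false by lia.
  have -> : (2 * k - (2 * k - 1 - i) = i.+1)%N by lia.
  by rewrite addr0 oppr0 opprK add0r mulrCA mulfV // mulr1.
have -> : (2 * k - 1 - i < k)%N by lia.
have -> : ((2 * k - 1 - i).+1 = 2 * k - i)%N by lia.
by rewrite oppr0 opprK add0r.
Qed.

(** * The functions [f1] and [f2], and the derivative of [f1] *)

Lemma cos_half_sqr (R : realType) (p : R) : cos (2 * p) = 2 * cos p ^+ 2 - 1.
Proof. by rewrite mulr_natl cos_mulr2n -mulr_natl. Qed.

Lemma cos_gtN1 (R : realType) (t : R) : - pi < t < pi -> 0 < cos t + 1.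
Proof.
move=> /andP[t1 t2]; have -> : t = 2 * (t / 2) by rewrite mulrCA mulfV // mulr1.
rewrite cos_half_sqr subrK mulr_gt0 // exprn_gt0 // cos_gt0_pihalf //.
by apply/andP; split; lra.
Qed.

Lemma f2E (R : realType) (t : R) : - pi < t < pi -> f2 t = - 1 - f1 t.
Proof. by move=> /cos_gtN1 c_gt0; rewrite /f1 /f2; field; lra. Qed.

Lemma f1_gt0 (R : realType) (t : R) : - pi < t < pi -> 0 < f1 t.
Proof.
move=> /cos_gtN1 c_gt0; rewrite /f1 divr_gt0 //; last lra.
rewrite addrC subr_gt0 -[ltLHS]ger0_norm ?(ltW c_gt0) // -sqrtr_sqr.
by rewrite ltr_sqrt; nra.
Qed.

(** In the half angle the factor [2 * cos p] leaves the square root, which gives the form used by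
    [branch] and [chareq]. *)
Lemma f1_half (R : realType) (p : R) : 0 < cos p ->
  f1 (2 * p) = (Num.sqrt (1 + cos p ^+ 2) - cos p) / (2 * cos p).
Proof.
rewrite /f1 cos_half_sqr; set c := cos p => c_gt0.
have -> : (2 * c ^+ 2 - 1 + 1) * (2 * c ^+ 2 - 1 + 3) = (2 * c) ^+ 2 * (1 + c ^+ 2).
  by ring.
rewrite sqrtrM ?sqr_ge0 // sqrtr_sqr ger0_norm; last by rewrite mulr_ge0 // ltW.
by field; apply/andP; split; apply: lt0r_neq0; nra.
Qed.

Definition df1 (R : realType) (t : R) : R :=
  sin t / (2 * (cos t + 1) * Num.sqrt ((cos t + 1) * (cos t + 3))).

Lemma is_derive_f1 (R : realType) (t : R) : - pi < t < pi ->
  is_derive t 1 (@f1 R) (df1 t).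
Proof.
move=> /cos_gtN1 c_gt0.
have q_gt0 : 0 < (cos t + 1) * (cos t + 3) by rewrite mulr_gt0 //; lra.
have w_gt0 : 0 < Num.sqrt ((cos t + 1) * (cos t + 3)) by rewrite sqrtr_gt0.
have w_sqr : Num.sqrt ((cos t + 1) * (cos t + 3)) ^+ 2 = (cos t + 1) * (cos t + 3).
  by rewrite sqr_sqrtr // ltW.
have dq : is_derive t 1 (fun x : R => (cos x + 1) * (cos x + 3))
    (- sin t * (2 * cos t + 4)).
  apply: is_derive_eq; rewrite /= !addr0 /GRing.scale /=; ring.
have dw : is_derive t 1 (fun x : R => Num.sqrt ((cos x + 1) * (cos x + 3)))
    (- sin t * (2 * cos t + 4) / (2 * Num.sqrt ((cos t + 1) * (cos t + 3)))).
  have ds := is_derive1_sqrt q_gt0.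
  have dc := @is_derive1_comp R Num.sqrt (fun x : R => (cos x + 1) * (cos x + 3)) t _ _ ds dq.
  by apply: (is_derive_eq dc); rewrite mulrC.
have dn : is_derive t 1
    (fun x : R => - (cos x + 1) + Num.sqrt ((cos x + 1) * (cos x + 3)))
    (sin t - sin t * (2 * cos t + 4) / (2 * Num.sqrt ((cos t + 1) * (cos t + 3)))).
  by apply: is_derive_eq; rewrite /= addr0; ring.
have dd : is_derive t 1 (fun x : R => 2 * (cos x + 1)) (- 2 * sin t).
  by apply: is_derive_eq; rewrite /= addr0 /GRing.scale /=; ring.
have d_neq0 : 2 * (cos t + 1) != 0 by lra.
have di := @is_deriveV R (fun x : R => 2 * (cos x + 1)) t _ _ d_neq0 dd.
apply: (is_derive_eq (@is_deriveM _ _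
  (fun x : R => - (cos x + 1) + Num.sqrt ((cos x + 1) * (cos x + 3)))
  (fun x : R => (2 * (cos x + 1))^-1) _ _ _ _ dn di)); rewrite /GRing.scale /= /df1.
move: w_gt0 w_sqr; set w := Num.sqrt _ => w_gt0 w_sqr.
(* This makes the bracket [w / (cos t + 1) - (cos t + 2) / w] below collapse to [1 / w]. *)
have w_div : w / (cos t + 1) = (cos t + 3) / w.
  by apply/eqP; rewrite eqr_div ?lt0r_neq0 // -expr2 w_sqr mulrC.
transitivity (sin t / (2 * (cos t + 1)) * (w / (cos t + 1) - (cos t + 2) / w)).
  by field; rewrite !lt0r_neq0.
by rewrite w_div; field; rewrite !lt0r_neq0.
Qed.

Lemma df1_gt0 (R : realType) (t : R) : 0 < t < pi -> 0 < df1 t.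
Proof.
move=> /andP[t_gt0 t_lt]; have c_gt0 : 0 < cos t + 1.
  by apply: cos_gtN1; rewrite t_lt andbT; lra.
rewrite /df1 divr_gt0 ?sin_gt0_pi ?t_gt0 // !mulr_gt0 // sqrtr_gt0 mulr_gt0 //.
Qed.

Lemma df1_sqr (R : realType) (t : R) : - pi < t < pi ->
  df1 t ^+ 2 = (1 - cos t) / (4 * (cos t + 1) ^+ 2 * (cos t + 3)).
Proof.
move=> /cos_gtN1 c_gt0; rewrite /df1 expr_div_n sin2cos2.
rewrite exprMn sqr_sqrtr; last by rewrite mulr_ge0 //; lra.
by field; apply/andP; split; lra.
Qed.

(** Both values are positive, so their squares may be compared. By [df1_sqr] the square is a
    function of [cos t] whose numerator decreases and whose denominator increases with the cosine,
    and the cosine decreases. *)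
Lemma df1_le (R : realType) (s t : R) : 0 < s -> s <= t -> t < pi ->
  df1 s <= df1 t.
Proof.
move=> s_gt0 st t_pi.
have Npi : - pi < 0 :> R by rewrite oppr_lt0 pi_gt0.
have t_rng : - pi < t < pi by apply/andP; split; lra.
have s_rng : - pi < s < pi by apply/andP; split; lra.
have c_le : cos t <= cos s.
  rewrite le_eqVlt; move: st; rewrite le_eqVlt => /orP[/eqP->|st]; first by rewrite eqxx.
  by rewrite ltr_cos ?st ?orbT // in_itv /=; apply/andP; split; lra.
have ct := cos_gtN1 t_rng; have s1 := cos_le1 s.
rewrite -ler_sqr ?nnegrE; last 2 first.
- by rewrite ltW // df1_gt0 //; apply/andP; split; lra.
- by rewrite ltW // df1_gt0 //; apply/andP; split; lra.
have den_gt0 (x : R) : 0 < x + 1 -> 0 < 4 * (x + 1) ^+ 2 * (x + 3).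
  by move=> x1; rewrite !mulr_gt0 ?exprn_gt0 //; lra.
have cs : 0 < cos s + 1 by lra.
rewrite !df1_sqr //; apply: ler_pM.
- by lra.
- by rewrite invr_ge0 ltW ?den_gt0.
- by lra.
rewrite lef_pV2 ?posrE ?den_gt0 //.
apply: ler_pM; rewrite ?mulr_ge0 ?sqr_ge0 //; try lra.
by rewrite ler_pM2l // ler_sqr ?nnegrE; lra.
Qed.

Lemma f1_mvt (R : realType) (s t : R) : 0 < s -> s < t -> t < pi ->
  exists2 c, s < c < t & f1 t - f1 s = df1 c * (t - s).
Proof.
move=> s_gt0 st t_pi.
have rng x : s <= x <= t -> - pi < x < pi.
  by move=> /andP[x1 x2]; have pi0 := pi_gt0 R; apply/andP; split; lra.
have [||c] := @MVT R (@f1 R) (@df1 R) s t st; last by rewrite in_itv; exists c.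
- move=> x; rewrite in_itv /= => /andP[x1 x2]; apply: is_derive_f1.
  by apply: rng; rewrite !ltW.
apply: derivable_within_continuous => x; rewrite in_itv /= => /rng x_rng.
by have [] := is_derive_f1 x_rng.
Qed.

Lemma f1_lt (R : realType) (s t : R) : 0 < s -> s < t -> t < pi -> f1 s < f1 t.
Proof.
move=> s_gt0 st t_pi; have [c /andP[c1 c2] E] := f1_mvt s_gt0 st t_pi.
rewrite -subr_gt0 E mulr_gt0 ?subr_gt0 // df1_gt0 //.
by apply/andP; split; lra.
Qed.

Lemma derive1_f1 (R : realType) (t : R) : - pi < t < pi -> derive1 (@f1 R) t = df1 t.
Proof. by move=> t_rng; rewrite derive1E; have [] := is_derive_f1 t_rng. Qed.

(** The intermediate slope of the mean value theorem is at most the slope at the right end, by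
    [df1_le]. *)
Lemma f1_dist_le (R : realType) (s t : R) : 0 < s -> s <= t -> t < pi ->
  `|f1 s - f1 t| <= df1 t * (t - s).
Proof.
move=> s_gt0; rewrite le_eqVlt => /orP[/eqP->|st] t_pi.
  by rewrite !subrr mulr0 normr0.
have [c /andP[c1 c2] E] := f1_mvt s_gt0 st t_pi.
rewrite distrC ger0_norm; last by rewrite subr_ge0 ltW // f1_lt.
by rewrite E ler_wpM2r ?subr_ge0 ?(ltW st) // df1_le //; lra.
Qed.

(** * Locating the roots of the characteristic equation *)

Lemma ivt_sign_change (R : realType) (f : R -> R) (a b : R) :
  a < b -> continuous f -> f a * f b < 0 ->
  exists2 c, a < c < b & f c = 0.
Proof.
move=> ab f_cont fab.
have [||c] := @IVT R f a b 0 (ltW ab).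
- by move=> x; apply: continuous_subspaceT.
- by rewrite ge_min le_max; case: (lerP (f a) 0) => fa; case: (lerP (f b) 0) => fb;
    rewrite ?orbT //=; nra.
rewrite in_itv /= => /andP[ac cb] fc; exists c => //.
rewrite !lt_neqAle ac cb !andbT; apply/andP; split.
  by apply: contraTneq fab => ->; rewrite fc mul0r ltxx.
by apply: contraTneq fab => <-; rewrite fc mulr0 ltxx.
Qed.

(* With [t = 2 p] and [a] the root [branch s p] of [a (a + 1) (2 + 2 cos t) = 1],
   this is [(a - 1) sin (k t) + a sin ((k - 1) t)] with its denominator cancelled, so
   that it stays continuous at [p = pi / 2]; [s = 1] gives [f1], [s = -1] [f2]. *)
Definition chareq (R : realType) (k : nat) (s p : R) : R :=
  (s * Num.sqrt (1 + cos p ^+ 2) - 2 * cos p) * sin ((2 * k%:R - 1) * p)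
  - cos ((2 * k%:R - 1) * p) * sin p.

Lemma chareq_continuous (R : realType) (k : nat) (s : R) : continuous (@chareq R k s).
Proof.
move=> p; rewrite /chareq.
have cM : ((2 * k%:R - 1) * x @[x --> p] --> (2 * k%:R - 1) * p)%classic.
  exact: mulrl_continuous.
apply: cvgB; apply: cvgM.
- apply: cvgB; apply: cvgM; [exact: cvg_cst| |exact: cvg_cst|exact: continuous_cos].
  apply: continuous_cvg; first exact: sqrt_continuous.
  apply: cvgD; first exact: cvg_cst.
  by apply: cvgM; exact: continuous_cos.
- by apply: continuous_cvg; first exact: continuous_sin.
- by apply: continuous_cvg; first exact: continuous_cos.
- exact: continuous_sin.
Qed.

Lemma gamma_half (R : realType) (k j : nat) : (0 < k)%N ->
  (2 * k%:R - 1) * (gamma R k j / 2) = pi *+ j.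
Proof.
move=> k_gt0; have : 1 <= k%:R :> R by rewrite ler1n.
by move=> k1; rewrite /gamma -mulr_natr; field; lra.
Qed.

Lemma gamma_lt (R : realType) (k i j : nat) : (0 < k)%N -> (i < j)%N ->
  gamma R k i < gamma R k j.
Proof.
move=> k_gt0 ij; have k1 : 1 <= k%:R :> R by rewrite ler1n.
rewrite /gamma ltr_pM2r ?invr_gt0; last lra.
by rewrite ltr_pM2l ?ltr_nat // mulr_gt0 ?pi_gt0.
Qed.

Lemma gamma_lt_pi (R : realType) (k j : nat) : (j < k)%N -> gamma R k j < pi.
Proof.
move=> jk; have jk' : j%:R + 1 <= k%:R :> R by rewrite natr1 ler_nat.
have j0 : 0 <= j%:R :> R by rewrite ler0n.
rewrite /gamma ltr_pdivrMr; last by lra.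
have := pi_gt0 R; nra.
Qed.

Lemma gamma0 (R : realType) (k : nat) : gamma R k 0 = 0.
Proof. by rewrite /gamma mulr0 mul0r. Qed.

(** The sine multiplying the term in [s] vanishes at these nodes, so both branches show the same
    alternating signs. *)
Lemma chareq_gamma (R : realType) (k j : nat) (s : R) : (0 < k)%N ->
  chareq k s (gamma R k j / 2) = - ((-1) ^+ j * sin (gamma R k j / 2)).
Proof.
move=> k_gt0; rewrite /chareq gamma_half // -[pi *+ j]add0r.
rewrite (alternatingn (@sinDpi R)) (alternatingn (@cosDpi R)) sin0 cos0.
by ring.
Qed.

(** [chareq] vanishes at [gamma_0 = 0], which therefore gives no sign; the midpoint of the first
    half-angle interval replaces it. There [p <= pi / 6], so [cos (2 * p) > 0], whence
    [3 * cos p ^+ 2 > 1] and [2 * cos p] exceeds the square root. *)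
Lemma chareq_first (R : realType) (k : nat) (s : R) : (1 < k)%N -> s <= 1 ->
  chareq k s (pi / 2 / (2 * k%:R - 1)) < 0.
Proof.
move=> k_gt1 s1; have k2 : 2 <= k%:R :> R by rewrite ler_nat.
have pi0 := pi_gt0 R.
set p := pi / 2 / _.
have pE : (2 * k%:R - 1) * p = pi / 2 by rewrite /p; field; lra.
have p0 : 0 < p by rewrite /p !divr_gt0 //; lra.
have p3 : 3 * p <= pi / 2 by rewrite -pE; apply: ler_wpM2r; [exact: ltW|lra].
have c0 : 0 < cos p by apply: cos_gt0_pihalf; apply/andP; split; lra.
have c1 : 0 < cos (2 * p) by apply: cos_gt0_pihalf; apply/andP; split; lra.
rewrite /chareq pE sin_pihalf cos_pihalf mul0r subr0 mulr1 subr_lt0.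
rewrite cos_half_sqr in c1.
apply: (@le_lt_trans _ _ (Num.sqrt (1 + cos p ^+ 2))).
  by rewrite ger_pMl // sqrtr_gt0 ltr_pwDl ?sqr_ge0.
rewrite -[ltRHS]ger0_norm; last by rewrite mulr_ge0 // ltW.
by rewrite -sqrtr_sqr ltr_sqrt; nra.
Qed.

(** This sign is opposite to the one at [gamma_(k-1) / 2] exactly when [s > 0], which is how the
    positive branch gets one root more than the negative one. *)
Lemma chareq_pihalf (R : realType) (k : nat) (s : R) : (0 < k)%N ->
  chareq k s (pi / 2) = s * (-1) ^+ (k - 1).
Proof.
move=> k_gt0; rewrite /chareq cos_pihalf.
have -> : (2 * k%:R - 1) * (pi / 2) = pi / 2 + pi *+ (k - 1) :> R.
  by rewrite -[in LHS](subnK k_gt0) natrD -mulr_natr; field.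
rewrite (alternatingn (@sinDpi R)) (alternatingn (@cosDpi R)) sin_pihalf cos_pihalf.
by rewrite expr0n /= addr0 sqrtr1; ring.
Qed.

Lemma chareq_root (R : realType) (k j : nat) (s : R) :
    (1 < k)%N -> s <= 1 -> (j < k - 1)%N \/ 0 < s /\ j = (k - 1)%N ->
  exists p, [/\ gamma R k j < p, p < gamma R k j.+1, 0 < p < pi
    & chareq k s (p / 2) = 0].
Proof.
move=> k_gt1 s1 j_case.
have k_gt0 : (0 < k)%N by exact: ltnW.
have k2 : 2 <= k%:R :> R by rewrite ler_nat.
have pi0 := pi_gt0 R.
have gamma_ge0 i : 0 <= gamma R k i.
  by rewrite /gamma divr_ge0 ?mulr_ge0 ?ler0n // ?ltW //; lra.
have sin_gamma i : (0 < i)%N -> (i < k)%N -> 0 < sin (gamma R k i / 2).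
  move=> i0 ik; have := gamma_lt R k_gt0 i0; rewrite gamma0 => g0.
  have := gamma_lt_pi R ik => g1.
  by apply: sin_gt0_pi; apply/andP; split; lra.
suff [a [b [ab ga bg b_pi signs]]] : exists a b : R,
    [/\ a < b, gamma R k j / 2 <= a, b <= gamma R k j.+1 / 2, b <= pi / 2
      & chareq k s a * chareq k s b < 0].
  have [p /andP[ap pb] p_root] := ivt_sign_change ab (@chareq_continuous R k s) signs.
  have g0 := gamma_ge0 j.
  exists (2 * p); rewrite mulrAC divff // mul1r; split => //; try lra.
have gj := gamma_lt R k_gt0 (ltnSn j).
have gj1 := gamma_ge0 j.
case: j_case => [j_lt|[s0 j_eq]].
- have j1k : (j.+1 < k)%N by lia.
  have gj2 := gamma_lt_pi R j1k.
  have [j0|j_gt0] := posnP j.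
    (* First interval: the left end is moved to the point of [chareq_first]. *)
    exists (pi / 2 / (2 * k%:R - 1)), (gamma R k 1 / 2).
    have E : gamma R k 1 / 2 = 2 * (pi / 2 / (2 * k%:R - 1)).
      by rewrite /gamma; field; lra.
    have h0 : 0 < pi / 2 / (2 * k%:R - 1) :> R by rewrite !divr_gt0 //; lra.
    rewrite j0 gamma0 in gj gj1 gj2 *.
    split; try lra.
    rewrite nmulr_rlt0; last exact: chareq_first.
    by rewrite chareq_gamma // expr1 mulN1r opprK sin_gamma //.
  exists (gamma R k j / 2), (gamma R k j.+1 / 2); split; try lra.
  rewrite !chareq_gamma // exprS.
  have -> : - ((-1) ^+ j * sin (gamma R k j / 2)) *
     - (-1 * (-1) ^+ j * sin (gamma R k j.+1 / 2))
    = - (((-1) ^+ j) ^+ 2 * (sin (gamma R k j / 2) * sin (gamma R k j.+1 / 2))) by ring.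
  by rewrite sqrr_sign mul1r oppr_lt0 mulr_gt0 ?sin_gamma //; lia.
have jk : (j < k)%N by lia.
(* Last interval: [gamma_k] lies beyond [pi], so the search stops at the half angle [pi / 2]. *)
exists (gamma R k j / 2), (pi / 2).
have gpi := gamma_lt_pi R jk.
have gpi' : pi <= gamma R k j.+1.
  rewrite /gamma ler_pdivlMr; last lra.
  have -> : j.+1 = k by lia.
  by nra.
split; try lra.
rewrite chareq_gamma // chareq_pihalf // -j_eq.
have -> : - ((-1) ^+ j * sin (gamma R k j / 2)) * (s * (-1) ^+ j)
    = - (((-1) ^+ j) ^+ 2 * (sin (gamma R k j / 2) * s)) by ring.
by rewrite sqrr_sign mul1r oppr_lt0 mulr_gt0 ?sin_gamma //; lia.
Qed.

(** While [cos p > 0], this is [f1 (2 * p)] for [s = 1] and [f2 (2 * p)] for [s = -1]. *)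
Definition branch (R : realType) (s p : R) : R :=
  (s * Num.sqrt (1 + cos p ^+ 2) - cos p) / (2 * cos p).

Lemma chareq_eigenvalue (R : realType) (k : nat) (e : rel 'I_(2 * k))
    (l : 'I_(2 * k) -> 'I_(2 * k)) (s p : R) :
    (0 < k)%N -> injective l ->
    (forall x y, e x y = (x != y) && (2 * k - 1 <= l x + l y)%N) ->
    s ^+ 2 = 1 -> 0 < p < pi / 2 -> chareq k s p = 0 ->
  eigenvalue (adjacency R e) (branch s p).
Proof.
move=> k_gt0 l_inj eE s_sqr /andP[p_gt0 p_lt] p_root.
have pi0 := pi_gt0 R.
have c_gt0 : 0 < cos p by apply: cos_gt0_pihalf; apply/andP; split; lra.
have w_sqr : Num.sqrt (1 + cos p ^+ 2) ^+ 2 = 1 + cos p ^+ 2.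
  by rewrite sqr_sqrtr // addr_ge0 ?sqr_ge0.
have a_cos : branch s p * (branch s p + 1) * (2 + 2 * cos (2 * p)) = 1.
  transitivity (s ^+ 2 * Num.sqrt (1 + cos p ^+ 2) ^+ 2 - cos p ^+ 2).
    by rewrite cos_half_sqr /branch; field; exact: lt0r_neq0.
  by rewrite s_sqr w_sqr; ring.
apply: (threshold_eigenvalue_trig (t := 2 * p) k_gt0 l_inj eE) => //.
- by apply: contra_eq_neq a_cos => ->; rewrite !mul0r eq_sym oner_neq0.
- by rewrite lt0r_neq0 // sin_gt0_pi //; apply/andP; split; lra.
(* Expanding around the angle [(2k - 1) p] turns the condition into [(2a - 1) sin ((2k - 1) p) cos p
   - cos ((2k - 1) p) sin p], and [(2a - 1) cos p] is the first factor in [chareq]. *)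
have -> : k%:R * (2 * p) = (2 * k%:R - 1) * p + p by ring.
have -> : (k - 1)%N%:R * (2 * p) = (2 * k%:R - 1) * p - p.
  by rewrite natrB //; ring.
rewrite sinD sinB -p_root /chareq /branch; field; exact: lt0r_neq0.
Qed.

(** * The full spectrum and the error bounds *)

(** One more eigenvalue would give the characteristic polynomial, of degree [n], at least [n + 1]
    distinct roots. *)
Lemma eigenvalue_mem (F : fieldType) (n : nat) (A : 'M[F]_n) (rs : seq F) :
    uniq rs -> size rs = n -> {in rs, forall x, eigenvalue A x} ->
  forall x, eigenvalue A x = (x \in rs).
Proof.
move=> rs_uniq rs_size rs_eig x; apply/idP/idP => [x_eig|/rs_eig //].
apply: contraT => x_rs.
have : (size (x :: rs) < size (char_poly A))%N.
  apply: max_poly_roots; first by rewrite monic_neq0 // char_poly_monic.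
    apply/allP => y; rewrite inE -eigenvalue_root_char.
    by case/predU1P => [->|/rs_eig].
  by rewrite /= x_rs.
by rewrite size_char_poly /= rs_size ltnn.
Qed.

Theorem theorem6p2 (R : realType) (k : nat) (e : rel 'I_(2 * k))
    (lp ln : seq R)
    (simple_e : simple_graph e)
    (connected_e : connected_graph e)
    (antiregular_e : antiregular e)
    (lp_sorted : sorted (fun x y : R => x < y) lp)
    (lp_mem : forall x : R,
       (x \in lp) = eigenvalue (adjacency R e) x && (0 < x))
    (ln_sorted : sorted (fun x y : R => y < x) ln)
    (ln_mem : forall x : R,
       (x \in ln) = [&& eigenvalue (adjacency R e) x, x < 0 & x != -1])
    (j : nat) (j_range : (1 <= j <= k - 1)%N) :
  `| lp`_(j - 1) - f1 (gamma R k j) |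
      <= 2 * pi * derive1 (@f1 R) (gamma R k j) / (2 * k%:R - 1)
  /\
  `| ln`_(j - 1) - f2 (gamma R k j) |
      <= 2 * pi * derive1 (@f1 R) (gamma R k j) / (2 * k%:R - 1).
Proof.
have k_gt1 : (1 < k)%N by lia.
have k_gt0 : (0 < k)%N by exact: ltnW.
have pi0 := pi_gt0 R.
have [r [l l_inj deg_e]] : exists r : nat, exists2 l : 'I_(2 * k) -> 'I_(2 * k),
    injective l & forall x, (degree e x + (r <= l x) = (l x).+1)%N.
  by apply: antiregular_label => //; lia.
have eE := antiregular_threshold simple_e l_inj deg_e.
have gamma_ge0 i : 0 <= gamma R k i.
  case: i => [|i]; first by rewrite gamma0.
  by rewrite -(gamma0 R k) ltW ?gamma_lt.
have rng (t : R) : 0 <= t -> t < pi -> - pi < t < pi.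
  by move=> t0 tpi; apply/andP; split; lra.
(* Roots are indexed from [0]: [tp i] lies between [gamma_i] and [gamma_(i+1)], so [gamma_j] bounds
   the root of index [j - 1] from above. Outside the range the value [0] is a mere default. *)
have /boolp.choice[tp tpP] : forall i, exists t, (i < k)%N ->
    [/\ gamma R k i < t, t < gamma R k i.+1, 0 < t < pi & chareq k 1 (t / 2) = 0].
  move=> i; case: (ltnP i k) => ik; last by exists 0.
  have [||p pP] := @chareq_root R k i 1 k_gt1; [by []| |by exists p].
  by case: (ltnP i (k - 1)) => ?; [left|right; split=> //; lia].
have /boolp.choice[tn tnP] : forall i, exists t, (i < k - 1)%N ->
    [/\ gamma R k i < t, t < gamma R k i.+1, 0 < t < pi
      & chareq k (- 1) (t / 2) = 0].
  move=> i; case: (ltnP i (k - 1)) => ik; last by exists 0.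
  have [||p pP] := @chareq_root R k i (- 1) k_gt1; [by lra|by left|by exists p].
pose rp := mkseq (fun i => f1 (tp i)) k.
pose rn := mkseq (fun i => f2 (tn i)) (k - 1).
have rp_gt0 : {in rp, forall x, 0 < x}.
  move=> x /mapP[i]; rewrite mem_iota add0n => /tpP [_ _ /andP[t0 tpi] _] ->.
  by rewrite f1_gt0 // rng // ltW.
have rn_ltN1 : {in rn, forall x, x < - 1}.
  move=> x /mapP[i]; rewrite mem_iota add0n => /tnP [_ _ /andP[t0 tpi] _] ->.
  have t_rng := rng _ (ltW t0) tpi.
  by rewrite f2E //; have := f1_gt0 t_rng; lra.
have rp_sorted : sorted (fun x y : R => x < y) rp.
  apply/(sortedP 0) => i; rewrite size_mkseq => ik.
  rewrite !nth_mkseq // ?(ltnW ik) //.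
  have [_ lt1 /andP[t0 _] _] := tpP _ (ltnW ik).
  have [lt2 _ /andP[_ tpi] _] := tpP _ ik.
  by apply: f1_lt => //; apply: lt_trans lt2.
have rn_sorted : sorted (fun x y : R => y < x) rn.
  apply/(sortedP 0) => i; rewrite size_mkseq => ik.
  rewrite !nth_mkseq // ?(ltnW ik) //.
  have [_ lt1 /andP[t0 tpi'] _] := tnP _ (ltnW ik).
  have [lt2 _ /andP[t0' tpi] _] := tnP _ ik.
  rewrite !f2E ?rng ?(ltW t0) ?(ltW t0') // ltrD2l ltrN2.
  by apply: f1_lt => //; apply: lt_trans lt2.
have gt_trans : transitive (fun x y : R => y < x).
  by move=> y x z /= yx zy; apply: lt_trans yx.
have gt_irr : irreflexive (fun x y : R => y < x) by move=> x /=; rewrite ltxx.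
(* The signs separate [-1], [rp] and [rn], and [1 + k + (k - 1) = 2k] exhausts the spectrum. *)
have rs_eig : forall x, eigenvalue (adjacency R e) x = (x \in -1 :: rp ++ rn).
  apply: eigenvalue_mem.
  - rewrite /= mem_cat negb_or cat_uniq -andbA; apply/and5P; split.
    + by apply/negP => /rp_gt0; lra.
    + by apply/negP => /rn_ltN1; lra.
    + exact: lt_sorted_uniq.
    + by apply/hasPn => x /rn_ltN1 x1; apply/negP => /rp_gt0; lra.
    + exact: sorted_uniq rn_sorted.
  - by rewrite /= size_cat !size_mkseq; lia.
  move=> x; rewrite inE mem_cat => /or3P[/eqP->|/mapP[i]|/mapP[i]].
  - exact: threshold_eigenvalueN1 k_gt0 l_inj eE.
  - rewrite mem_iota add0n => /tpP [_ _ /andP[t0 tpi] root] ->.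
    have -> : tp i = 2 * (tp i / 2) by field.
    rewrite f1_half; last by apply: cos_gt0_pihalf; apply/andP; split; lra.
    rewrite -[Num.sqrt _]mul1r.
    apply: (chareq_eigenvalue k_gt0 l_inj eE) => //; first by rewrite expr1n.
    by apply/andP; split; lra.
  - rewrite mem_iota add0n => /tnP [_ _ /andP[t0 tpi] root] ->.
    have c_gt0 : 0 < cos (tn i / 2).
      by apply: cos_gt0_pihalf; apply/andP; split; lra.
    have -> : f2 (tn i) = branch (- 1) (tn i / 2).
      rewrite f2E ?rng ?(ltW t0) //.
      have -> : tn i = 2 * (tn i / 2) by field.
      by rewrite f1_half -?(mulrCA _ 2) ?mulfV ?mulr1 // /branch; field; lra.
    apply: (chareq_eigenvalue k_gt0 l_inj eE) => //; first by rewrite sqrrN expr1n.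
    by apply/andP; split; lra.
(* Strictly sorted lists with the same members are equal, which matches the numbering of the
   eigenvalues with that of the roots. *)
have lpE : lp = rp.
  apply: (@irr_sorted_eq _ (fun x y : R => x < y)) => //.
    exact: lt_trans.
  move=> x; rewrite lp_mem rs_eig inE mem_cat.
  apply/andP/idP => [[/or3P[/eqP->|//|/rn_ltN1] x0]|x_rp]; try lra.
  by rewrite x_rp orbT rp_gt0.
have lnE : ln = rn.
  apply: (irr_sorted_eq gt_trans gt_irr) => // x; rewrite ln_mem rs_eig inE mem_cat.
  apply/and3P/idP => [[/or3P[->|/rp_gt0|//] x0]|x_rn]; try lra.
  have x1 := rn_ltN1 _ x_rn.
  by rewrite x_rn !orbT; split=> //; [lra|rewrite lt_eqF].
have gpi := @gamma_lt_pi R k j.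
have jk : (j < k)%N by lia.
have k2 : 2 <= k%:R :> R by rewrite ler_nat.
have bound t : gamma R k (j - 1) < t -> t < gamma R k j ->
    `|f1 t - f1 (gamma R k j)| <= 2 * pi * derive1 (@f1 R) (gamma R k j) / (2 * k%:R - 1).
  move=> t1 t2; have t0 : 0 < t by apply: le_lt_trans t1.
  have g0 : 0 < gamma R k j by apply: lt_trans t2.
  rewrite derive1_f1 ?rng ?gpi ?(ltW g0) //.
  apply: le_trans (f1_dist_le t0 (ltW t2) (gpi jk)) _.
  (* Consecutive nodes differ by [2 * pi / (2k - 1)], and [t] lies between two of them. *)
  rewrite [leRHS](_ : _ = df1 (gamma R k j) * (gamma R k j - gamma R k (j - 1))).
    rewrite ler_wpM2l ?lerB ?(ltW t1) // ltW // df1_gt0 //.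
    by rewrite g0 gpi.
  by rewrite /gamma natrB ?(proj1 (andP j_range)) //; field; lra.
have j1 : (j - 1).+1 = j by lia.
split.
- rewrite lpE nth_mkseq; last lia.
  have [|t1 t2 _ _] := tpP (j - 1)%N; first lia.
  rewrite j1 in t2.
  exact: bound.
- rewrite lnE nth_mkseq; last lia.
  have [|t1 t2 /andP[t0 tpi] _] := tnP (j - 1)%N; first lia.
  rewrite j1 in t2.
  rewrite !f2E ?rng ?gpi ?(ltW t0) //.
  have -> : -1 - f1 (tn (j - 1)%N) - (-1 - f1 (gamma R k j))
    = - (f1 (tn (j - 1)%N) - f1 (gamma R k j)) by ring.
  by rewrite normrN; apply: bound.
Qed.
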